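(* The property $\neg\mathrm{AC}$ of abstract rewrite systems is not a generalised first-order property.
   Context: An ARS is a pair $(A,\to)$, $A$ non-empty, ${\to}\subseteq A\times A$; $\to^+$ is the transitive closure. The ARS is acyclic (AC) if $a\to^+b$ implies $a\neq b$; $\neg\mathrm{AC}$ is the property of not being acyclic. A property $P$ is a generalised first-order property if there is a set $\Phi$ of sentences of first-order logic with equality and a binary predicate symbol $\to$ (interpreted as the one-step relation) such that for every ARS $\mathcal{A}$, $\mathcal{A}$ has $P$ iff $\mathcal{A}\models\Phi$. *)

(* Defs.v *)
From Stdlib Require Import Relations Arith.

Record ARS : Type := mkARS {
  carrier :> Type;
  carrier_nonempty : inhabited carrier;
  step : relation carrier
}.

Definition acyclic (A : ARS) : Prop :=
  forall a b : A, clos_trans A (step A) a b -> a <> b.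

(** First-order logic with equality and one binary predicate symbol.
    Variables are named by natural numbers. *)

Inductive formula : Type :=
| fEq  : nat -> nat -> formula
| fArr : nat -> nat -> formula
| fNot : formula -> formula
| fAnd : formula -> formula -> formula
| fOr  : formula -> formula -> formula
| fImp : formula -> formula -> formula
| fAll : nat -> formula -> formula
| fEx  : nat -> formula -> formula.

Fixpoint occurs_free (x : nat) (phi : formula) : Prop :=
  match phi with
  | fEq y z | fArr y z => x = y \/ x = z
  | fNot p => occurs_free x p
  | fAnd p q | fOr p q | fImp p q => occurs_free x p \/ occurs_free x q
  | fAll y p | fEx y p => x <> y /\ occurs_free x p
  end.

Definition sentence (phi : formula) : Prop := forall x, ~ occurs_free x phi.

Definition update {T : Type} (rho : nat -> T) (x : nat) (a : T) : nat -> T :=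
  fun y => if Nat.eqb y x then a else rho y.

Fixpoint sat (A : ARS) (rho : nat -> A) (phi : formula) : Prop :=
  match phi with
  | fEq x y => rho x = rho y
  | fArr x y => step A (rho x) (rho y)
  | fNot p => ~ sat A rho p
  | fAnd p q => sat A rho p /\ sat A rho q
  | fOr p q => sat A rho p \/ sat A rho q
  | fImp p q => sat A rho p -> sat A rho q
  | fAll x p => forall a : A, sat A (update rho x a) p
  | fEx x p => exists a : A, sat A (update rho x a) p
  end.

(** For sentences the valuation is irrelevant; valuations exist because the
    carrier is non-empty. *)
Definition models (A : ARS) (Phi : formula -> Prop) : Prop :=
  forall phi, Phi phi -> forall rho : nat -> A, sat A rho phi.

Definition generalised_first_order (P : ARS -> Prop) : Prop :=
  exists Phi : formula -> Prop,
    (forall phi, Phi phi -> sentence phi) /\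
    (forall A : ARS, P A <-> models A Phi).

(* Main.v *)
From Stdlib Require Import ZArith Lia Relations Classical.
Require Import Defs.

(** For [n > 0] cut the integers into blocks of length [n] and make every block
    a directed cycle; for [n = 0] take the successor relation on the integers.
    The former systems are cyclic, the latter is acyclic, and an
    Ehrenfeucht-Fraisse argument shows that a sentence of quantifier depth [k]
    cannot tell them apart once [n > 2 ^ k]: Duplicator only has to preserve
    the distances of size at most [2 ^ j] when [j] rounds remain.  A set of
    sentences true in all the cyclic systems is thus true in the acyclic one. *)

Open Scope Z_scope.

(* Rocq's [z / 0 = 0] and [z mod 0 = z] give [rotate 0 d z = z + d]. *)
Definition rotate (n d z : Z) : Z := n * (z / n) + (z mod n + d) mod n.

Definition rotation (n : Z) : ARS :=
  mkARS Z (inhabits 0) (fun a b => b = rotate n 1 a).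

Lemma rotate_infinite (d z : Z) : rotate 0 d z = z + d.
Proof. unfold rotate. rewrite !Zmod_0_r. lia. Qed.

Lemma rotate_div (n d z : Z) : 0 < n -> rotate n d z / n = z / n.
Proof.
  intros Hn. unfold rotate.
  pose proof (Z.mod_pos_bound (z mod n + d) n Hn).
  rewrite Z.mul_comm, Z.div_add_l, (Z.div_small (_ mod _)) by lia. lia.
Qed.

Lemma rotate_mod (n d z : Z) : 0 < n -> rotate n d z mod n = (z + d) mod n.
Proof.
  intros Hn. unfold rotate.
  rewrite Z.add_comm, Z.mul_comm, Z_mod_plus_full, Zmod_mod.
  now rewrite Zplus_mod_idemp_l.
Qed.

Lemma rotate_rotate (n d e z : Z) :
  0 <= n -> rotate n d (rotate n e z) = rotate n (d + e) z.
Proof.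
  intros Hn. destruct (Z.eq_dec n 0) as [->|Hn0].
  - rewrite !rotate_infinite. lia.
  - unfold rotate at 1. rewrite rotate_div, rotate_mod by lia.
    unfold rotate. rewrite !Zplus_mod_idemp_l. do 2 f_equal. lia.
Qed.

Lemma rotate_0 (n z : Z) : 0 <= n -> rotate n 0 z = z.
Proof.
  intros Hn. destruct (Z.eq_dec n 0) as [->|Hn0].
  - rewrite rotate_infinite. lia.
  - unfold rotate. rewrite Z.add_0_r, Zmod_mod. symmetry. apply Z.div_mod. lia.
Qed.

Lemma rotate_sym (n d y z : Z) :
  0 <= n -> y = rotate n d z <-> z = rotate n (- d) y.
Proof.
  intros Hn; split; intros ->; rewrite rotate_rotate by lia;
    [rewrite Z.add_opp_diag_l | rewrite Z.add_opp_diag_r];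
    now rewrite rotate_0.
Qed.

(** For [n > 0] a rotation stays inside the block of [z], which begins above [z - n]; for [n = 0] it
    is a shift by [d]. *)
Lemma rotate_ge (n d z : Z) : 0 <= n -> z - n - Z.abs d <= rotate n d z.
Proof.
  intros Hn. destruct (Z.eq_dec n 0) as [->|Hn0].
  - rewrite rotate_infinite. lia.
  - unfold rotate.
    pose proof (Z.mod_pos_bound (z mod n + d) n ltac:(lia)).
    pose proof (Z.mod_pos_bound z n ltac:(lia)).
    pose proof (Z.div_mod z n Hn0). lia.
Qed.

(** The case [n = 0] counts as infinite cycle length. *)
Definition exceeds (n r : Z) : Prop := n = 0 \/ r < n.

(** A fixed point forces [n] to divide [d] when [n > 0], and a nonzero multiple of [n] is larger
    than [r] in absolute value. *)
Lemma rotate_fixed (n r d z : Z) :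
  0 <= r -> exceeds n r -> Z.abs d <= r -> z = rotate n d z <-> d = 0.
Proof.
  intros Hr [->|Hn] Hd.
  - rewrite rotate_infinite. lia.
  - split; [|intros ->; now rewrite rotate_0 by lia].
    intros E. apply (f_equal (fun t => t mod n)) in E.
    rewrite rotate_mod in E by lia.
    assert (D : d mod n = 0).
    { replace d with (z + d - z) by lia.
      rewrite Zminus_mod, <- E, Z.sub_diag. apply Zmod_0_l. }
    apply Z.mod_divide in D; [|lia]. destruct D as [q ->].
    rewrite Z.abs_mul in Hd. destruct (Z.eq_dec q 0) as [->|Hq]; nia.
Qed.

(** Duplicator's invariant. Displacement [0] is equality and [1] is an arrow, so for [r >= 1] it
    settles all atomic formulas. *)
Definition same_distances (r n m : Z) (rho sigma : nat -> Z) : Prop :=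
  forall x y d, Z.abs d <= r ->
    rho y = rotate n d (rho x) <-> sigma y = rotate m d (sigma x).

Lemma same_distances_sym (r n m : Z) (rho sigma : nat -> Z) :
  same_distances r n m rho sigma -> same_distances r m n sigma rho.
Proof. intros H x y d Hd. symmetry. now apply H. Qed.

(** A valuation places infinitely many points at once; a bound leaves room for one far from all of
    them. *)
Definition bounded_above (rho : nat -> Z) : Prop := exists M, forall x, rho x <= M.

Lemma bounded_above_update (rho : nat -> Z) (x : nat) (a : Z) :
  bounded_above rho -> bounded_above (update rho x a).
Proof.
  intros [M HM]. exists (Z.max M a). intros y. unfold update.
  destruct (Nat.eqb y x); [lia|]. specialize (HM y). lia.
Qed.

(** Displacements from old points to the new one suffice: the reverse ones follow by [rotate_sym],
    those from the new point to itself by [rotate_fixed]. *)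
Lemma same_distances_update (r n m : Z) (rho sigma : nat -> Z) (x : nat) (a b : Z) :
  0 <= r -> 0 <= n -> 0 <= m -> exceeds n r -> exceeds m r ->
  same_distances r n m rho sigma ->
  (forall y d, Z.abs d <= r -> a = rotate n d (rho y) <-> b = rotate m d (sigma y)) ->
  same_distances r n m (update rho x a) (update sigma x b).
Proof.
  intros Hr Hn Hm En Em H Hab y z d Hd. unfold update.
  destruct (Nat.eqb y x), (Nat.eqb z x).
  - now rewrite (rotate_fixed n r), (rotate_fixed m r).
  - rewrite (rotate_sym n), (rotate_sym m) by assumption. apply Hab. lia.
  - now apply Hab.
  - now apply H.
Qed.

(* Duplicator's move: copy the displacement if [a] is within [r] of an earlier
   point, otherwise play far beyond all earlier points. *)
Lemma same_distances_extend (r n m : Z) (rho sigma : nat -> Z) (x : nat) (a : Z) :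
  0 <= r -> 0 <= n -> 0 <= m -> exceeds n r -> exceeds m r ->
  bounded_above sigma -> same_distances (2 * r) n m rho sigma ->
  exists b, same_distances r n m (update rho x a) (update sigma x b).
Proof.
  intros Hr Hn Hm En Em [M HM] H.
  assert (H' : same_distances r n m rho sigma).
  { intros y z d Hd. apply H. lia. }
  destruct (classic (exists w e, Z.abs e <= r /\ a = rotate n e (rho w)))
    as [(w & e & He & ->)|Hfar].
  (* A displacement [d] to the new point turns into [- d + e] between earlier points, of size at
     most [2 * r]. *)
  - exists (rotate m e (sigma w)). apply same_distances_update; try assumption.
    intros y d Hd.
    rewrite (rotate_sym n), (rotate_sym m), !rotate_rotate by assumption.
    apply H. lia.
  (* By [rotate_ge], a move of size at most [r] lowers this point by at most [m + r], so it still
     ends above [M]. *)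
  - exists (M + m + r + 1). apply same_distances_update; try assumption.
    intros y d Hd; split; intros E; exfalso.
    + apply Hfar. now exists y, d.
    + apply rotate_sym in E; [|assumption].
      pose proof (rotate_ge m (- d) (M + m + r + 1) Hm).
      specialize (HM y). lia.
Qed.

Fixpoint quantifier_depth (phi : formula) : nat :=
  match phi with
  | fEq _ _ | fArr _ _ => 0
  | fNot p => quantifier_depth p
  | fAnd p q | fOr p q | fImp p q => max (quantifier_depth p) (quantifier_depth q)
  | fAll _ p | fEx _ p => S (quantifier_depth p)
  end.

(** [k] only bounds the depth, so that both sides of a binary connective can share it. *)
Lemma sat_rotation_iff (n m : Z) (phi : formula) (k : nat) (rho sigma : nat -> Z) :
  0 <= n -> 0 <= m -> (quantifier_depth phi <= k)%nat ->
  exceeds n (2 ^ Z.of_nat k) -> exceeds m (2 ^ Z.of_nat k) ->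
  bounded_above rho -> bounded_above sigma ->
  same_distances (2 ^ Z.of_nat k) n m rho sigma ->
  sat (rotation n) rho phi <-> sat (rotation m) sigma phi.
Proof.
  intros Hn Hm. revert k rho sigma.
  assert (Hpow : forall k, 0 < 2 ^ Z.of_nat k) by (intros; lia).
  induction phi as [x y|x y|p IHp|p IHp q IHq|p IHp q IHq|p IHp q IHq|x p IHp|x p IHp];
    intros k rho sigma Hk En Em Br Bs H; cbn in Hk |- *.
  1: { specialize (Hpow k). specialize (H y x 0 ltac:(lia)).
       now rewrite !rotate_0 in H. }
  1: { specialize (Hpow k). apply H. lia. }
  1: { now rewrite (IHp k rho sigma). }
  1-3: rewrite (IHp k rho sigma), (IHq k rho sigma) by (assumption || lia); reflexivity.
  (* A quantifier uses up one round and halves the radius; Spoiler may move in either system, hence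
     [Forth] and [Back]. *)
  all: destruct k as [|k]; [lia|];
    rewrite Nat2Z.inj_succ, Z.pow_succ_r in En, Em, H by lia;
    specialize (Hpow k);
    assert (En' : exceeds n (2 ^ Z.of_nat k)) by (unfold exceeds in *; lia);
    assert (Em' : exceeds m (2 ^ Z.of_nat k)) by (unfold exceeds in *; lia);
    assert (Hstep : forall a b : Z,
      same_distances (2 ^ Z.of_nat k) n m (update rho x a) (update sigma x b) ->
      sat (rotation n) (update rho x a) p <-> sat (rotation m) (update sigma x b) p)
      by (intros a b Hab; apply (IHp k);
          auto using bounded_above_update; lia);
    assert (Forth := fun a => same_distances_extend (2 ^ Z.of_nat k) n m rho sigma x a
      ltac:(lia) Hn Hm En' Em' Bs H);
    assert (Back : forall b, exists a,
      same_distances (2 ^ Z.of_nat k) n m (update rho x a) (update sigma x b))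
      by (intros b;
          destruct (same_distances_extend (2 ^ Z.of_nat k) m n sigma rho x b
            ltac:(lia) Hm Hn Em' En' Br (same_distances_sym _ _ _ _ _ H)) as [a Ha];
          exists a; now apply same_distances_sym).
  - split.
    + intros S b. destruct (Back b) as [a Ha]. apply (Hstep a b Ha), S.
    + intros S a. destruct (Forth a) as [b Hb]. apply (Hstep a b Hb), S.
  - split.
    + intros [a S]. destruct (Forth a) as [b Hb]. exists b. now apply (Hstep a b Hb).
    + intros [b S]. destruct (Back b) as [a Ha]. exists a. now apply (Hstep a b Ha).
Qed.

Lemma sat_agree (A : ARS) (phi : formula) (rho sigma : nat -> A) :
  (forall x, occurs_free x phi -> rho x = sigma x) ->
  sat A rho phi <-> sat A sigma phi.
Proof.
  revert rho sigma.
  induction phi as [x y|x y|p IHp|p IHp q IHq|p IHp q IHq|p IHp q IHq|x p IHp|x p IHp];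
    intros rho sigma H; cbn in H |- *.
  1-2: rewrite (H x), (H y) by auto; reflexivity.
  1: now rewrite (IHp rho sigma).
  1-3: rewrite (IHp rho sigma), (IHq rho sigma) by auto; reflexivity.
  all: assert (E : forall a, sat A (update rho x a) p <-> sat A (update sigma x a) p)
    by (intros a; apply IHp; intros y Hy; unfold update;
        destruct (Nat.eqb_spec y x); auto).
  - split; intros S a; apply E, S.
  - split; intros [a S]; exists a; apply E, S.
Qed.

Lemma acyclic_rotation_0 : acyclic (rotation 0).
Proof.
  intros a b H. cut (a < b); [cbn; lia|].
  induction H as [a b H|a b c _ IH1 _ IH2].
  - change (b = rotate 0 1 a) in H. rewrite rotate_infinite in H. cbn in *. lia.
  - cbn in *. lia.
Qed.

Lemma rotation_steps (n : Z) (k : nat) (z : Z) :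
  0 <= n -> clos_trans Z (step (rotation n)) z (rotate n (Z.of_nat (S k)) z).
Proof.
  intros Hn. induction k as [|k IH].
  - now apply t_step.
  - apply t_trans with (1 := IH), t_step. cbn.
    rewrite rotate_rotate by assumption. f_equal. lia.
Qed.

Lemma cyclic_rotation (n : Z) : 0 < n -> ~ acyclic (rotation n).
Proof.
  intros Hn H.
  apply (H 0 (rotate n n 0)).
  (* A full turn takes [n] steps; [rotation_steps] counts them as a successor, hence [n - 1]. *)
  - pose proof (rotation_steps n (Z.to_nat (n - 1)) 0 ltac:(lia)) as C.
    now replace (Z.of_nat (S (Z.to_nat (n - 1)))) with n in C by lia.
  - unfold rotate. now rewrite Zdiv_0_l, Zmod_0_l, Z.add_0_l, Z_mod_same_full, Z.mul_0_r.
Qed.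

Theorem theorem3p10 : ~ generalised_first_order (fun A : ARS => ~ acyclic A).
Proof.
  intros (Phi & Hsent & HPhi).
  apply (proj2 (HPhi (rotation 0))); [|exact acyclic_rotation_0].
  intros phi Hphi rho.
  set (r := 2 ^ Z.of_nat (quantifier_depth phi)).
  assert (Hr : 0 < r) by (unfold r; lia).
  set (zero := fun _ : nat => 0).
  assert (B : bounded_above zero) by (exists 0; now intros x).
  (* [rho] may be unbounded, but a sentence does not depend on it. *)
  apply (sat_agree (rotation 0) phi rho zero).
  { intros x Hx. now destruct (Hsent phi Hphi x). }
  (* The cycle length is chosen for each [phi] separately: [r + 1] is the least one exceeding
     [r]. *)
  apply (sat_rotation_iff 0 (r + 1) phi (quantifier_depth phi) zero zero);
    try assumption; try lia.
  - now left.
  - right. fold r. lia.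
  (* All points coincide, so on both sides only displacement [0] occurs within radius [r]. *)
  - intros x y d Hd. fold r in Hd. unfold zero.
    rewrite (rotate_fixed 0 r), (rotate_fixed (r + 1) r);
      unfold exceeds; try lia; reflexivity.
  - apply (proj1 (HPhi (rotation (r + 1)))); [|assumption].
    apply cyclic_rotation. lia.
Qed.
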